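(* Let $\mathcal{F}(q)=\sum_{n\ge0}b(n)q^n$ be the ordinary generating function of block-separated overpartitions. Then $$\mathcal{F}(q)=\frac{1}{(q)_\infty}\left(\widehat{F}_0^{(\infty)}(q)+\widehat{F}_1^{(\infty)}(q)\right),$$ where the sequences $\widehat{F}_0^{(n)}=\widehat{F}_0^{(n)}(q)$ and $\widehat{F}_1^{(n)}=\widehat{F}_1^{(n)}(q)$ satisfy, for $n\ge 1$, the coupled recurrences $$\widehat{F}_0^{(n)}=\widehat{F}_0^{(n-1)}+q^n\widehat{F}_1^{(n-1)},\qquad \widehat{F}_1^{(n)}=q^n\widehat{F}_0^{(n-1)}+(1-q^n)\widehat{F}_1^{(n-1)},$$ with initial conditions $\widehat{F}_0^{(0)}=1$, $\widehat{F}_1^{(0)}=0$.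
   Context: A partition of $n$ is written in block form $(d_1^{m_1},\dots,d_r^{m_r})$ with $d_1>d_2>\cdots>d_r\ge 1$, multiplicities $m_i\ge 1$, and $\sum_i m_i d_i=n$. An overpartition of $n$ is a partition of $n$ in which the first occurrence of each distinct part may optionally be overlined; let $x_i\in\{0,1\}$ equal $1$ if and only if the first occurrence in the block $d_i^{m_i}$ is overlined. An overpartition is block-separated if no two consecutive distinct blocks are both overlined, i.e. $x_i x_{i+1}=0$ for all $i=1,\dots,r-1$. $b(n)$ is the number of block-separated overpartitions of $n$, with $b(0)=1$ (the empty overpartition). $(q)_\infty=\prod_{j\ge1}(1-q^j)$. $\widehat{F}_0^{(\infty)}(q)$ and $\widehat{F}_1^{(\infty)}(q)$ denote the coefficientwise limits, as formal power series in $q$, of the polynomials $\widehat{F}_0^{(n)}(q)$ and $\widehat{F}_1^{(n)}(q)$ as $n\to\infty$. The identity is one of formal power series in $q$. *)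

(* Defs.v *)
From mathcomp Require Import all_boot all_order all_algebra.

Set Implicit Arguments.
Unset Strict Implicit.
Unset Printing Implicit Defensive.

Import GRing.Theory.

(* The triple (d, m, x) is the block d^m of m copies of the part d, whose first
   occurrence is overlined iff x = true. *)
Definition block : Type := nat * nat * bool.
Definition bpart (B : block) : nat := B.1.1.
Definition bmult (B : block) : nat := B.1.2.
Definition overlined (B : block) : bool := B.2.

Definition is_overpartition (n : nat) (s : seq block) : bool :=
  [&& sorted (fun B C => bpart C < bpart B) s,
      all (fun B => (0 < bpart B) && (0 < bmult B)) s
    & \sum_(B <- s) bmult B * bpart B == n].

(* [sorted r s] only relates adjacent entries of [s]; r need not be transitive. *)
Definition block_separated (s : seq block) : bool :=
  sorted (fun B C => ~~ (overlined B && overlined C)) s.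

(* An overpartition of n has at most n blocks, with parts and multiplicities at
   most n (lemma [overpartition_bounded]), so the following finite type holds them all. *)
Definition bounded_blocks (n : nat) := n.-bseq ('I_n.+1 * 'I_n.+1 * bool).

Definition blocks_of (n : nat) (t : bounded_blocks n) : seq block :=
  [seq (val B.1.1, val B.1.2, B.2) | B <- t].

Definition b (n : nat) : nat :=
  #|[set t : bounded_blocks n |
      is_overpartition n (blocks_of t) && block_separated (blocks_of t)]|.

Lemma blocks_of_inj n : injective (@blocks_of n).
Proof.
move=> s t /inj_map e; apply/val_inj/e => -[[d m] x] [[d' m'] x'] /= [].
by move=> /val_inj -> /val_inj -> ->.
Qed.

Lemma overpartition_bounded n (s : seq block) :
  is_overpartition n s -> exists t : bounded_blocks n, blocks_of t = s.
Proof.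
case/and3P=> _ /allP pos /eqP sum_s.
have bnd B : B \in s -> bpart B <= n /\ bmult B <= n.
  move=> Bs; have /andP[d0 m0] := pos B Bs.
  have le_n : bmult B * bpart B <= n by rewrite -sum_s (big_rem B) //= leq_addr.
  by split; apply: leq_trans le_n; rewrite ?leq_pmull ?leq_pmulr.
have size_s : size s <= n.
  rewrite -sum_s -sum1_size big_seq [leqRHS]big_seq; apply: leq_sum => B /pos.
  by rewrite muln_gt0 andbC.
pose f (B : block) : 'I_n.+1 * 'I_n.+1 * bool :=
  (inord (bpart B), inord (bmult B), overlined B).
have size_fs : size (map f s) <= n by rewrite size_map.
exists (Bseq size_fs); rewrite /blocks_of /= -map_comp -[RHS]map_id.
apply/eq_in_map => -[[d m] x] /bnd[/= led lem].
by rewrite !inordK // ltnS.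
Qed.

Local Open Scope ring_scope.

(* Formal power series in q over int, given by their coefficients. *)
Definition fps : Type := nat -> int.

Definition fps_add (f g : fps) : fps := fun k => f k + g k.

Definition fps_mul (f g : fps) : fps :=
  fun k => \sum_(i < k.+1) f i * g (k - i)%N.

Definition fps_one : fps := fun k => (k == 0%N)%:R.

(* First n.+1 coefficients of 1 / f, for f 0 invertible. *)
Fixpoint fps_inv_seq (f : fps) (n : nat) : seq int :=
  if n is n'.+1 then
    let s := fps_inv_seq f n' in
    rcons s (- (f 0%N)^-1 * \sum_(i < n) f (n - i)%N * s`_i)
  else [:: (f 0%N)^-1].

Definition fps_inv (f : fps) : fps := fun n => (fps_inv_seq f n)`_n.

Lemma fps_mulfV (f : fps) :
  f 0%N \is a GRing.unit -> fps_mul f (fps_inv f) =1 fps_one.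
Proof.
move=> f0U; have size_s n : size (fps_inv_seq f n) = n.+1.
  by elim: n => //= n IHn; rewrite size_rcons IHn.
have nth_s n i : (i <= n)%N -> (fps_inv_seq f n)`_i = fps_inv f i.
  elim: n => [|n IHn]; first by rewrite leqn0 => /eqP ->.
  rewrite leq_eqVlt => /orP[/eqP -> //|].
  by rewrite ltnS => lein; rewrite /= nth_rcons size_s ltnS lein IHn.
case=> [|n]; rewrite /fps_mul /fps_one.
  by rewrite big_ord1 /fps_inv /= mulrV.
rewrite big_ord_recl subn0 {1}/fps_inv /= nth_rcons size_s ltnn eqxx.
rewrite mulNr mulrN mulrA mulrV // mul1r.
apply/eqP; rewrite addrC subr_eq0; apply/eqP.
rewrite [RHS](reindex_inj rev_ord_inj) /=; apply: eq_bigr => i _.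
rewrite /bump add1n !subSS nth_s ?leq_subr // subSn ?leq_subr //.
by rewrite subKn // -ltnS.
Qed.

(* u converges coefficientwise to f: every coefficient is eventually constant. *)
Definition is_fps_lim (u : nat -> {poly int}) (f : fps) : Prop :=
  forall k, exists N, forall n, (N <= n)%N -> (u n)`_k = f k.

Lemma is_fps_lim_unique u f g : is_fps_lim u f -> is_fps_lim u g -> f =1 g.
Proof.
move=> uf ug k; have [M fM] := uf k; have [N gN] := ug k.
by rewrite -(fM (maxn M N)) ?leq_maxl // gN // leq_maxr.
Qed.

(* The finite products (q)_n, whose coefficientwise limit is (q)_oo. *)
Definition qpoch (n : nat) : {poly int} := \prod_(1 <= j < n.+1) (1 - 'X^j).

Definition genfun_b : fps := fun n => (b n)%:R.

(* Main.v *)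
(* Build the overpartitions by adding the part sizes 1, 2, 3, ... in turn, and
   let G0 and G1 count those with parts at most n whose largest block is plain,
   respectively overlined (the empty one counts as plain). The new part size n
   is absent, or present with some multiplicity: plain above either state,
   overlined only above the plain one. So
     G0^(n) = (G0 + q^n G1) / (1 - q^n),
     G1^(n) = (q^n G0 + (1 - q^n) G1) / (1 - q^n),
   with G0, G1 taken at n - 1, and (q)_n G0^(n), (q)_n G1^(n) satisfy the
   recurrences that define F0 and F1. *)
Require Import Defs.
From mathcomp Require Import all_boot all_order all_algebra.
From mathcomp Require Import ring zify.

Set Implicit Arguments.
Unset Strict Implicit.
Unset Printing Implicit Defensive.

Import GRing.Theory.

(** * Enumeration of block-separated overpartitions with bounded parts *)

Definition head_overlined (s : seq block) : bool :=
  if s is B :: _ then overlined B else false.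

Definition mults (d k : nat) : seq nat := iota 1 (k %/ d).

(** Only block-separated overpartitions are listed: [n] bounds the parts, [k] is the total, and the
    filter enforces the separation. *)
Fixpoint overpartitions (n k : nat) : seq (seq block) :=
  if n is n'.+1 then
    overpartitions n' k ++
    ([seq (n, m, false) :: s | m <- mults n k,
                               s <- overpartitions n' (k - m * n)] ++
     [seq (n, m, true) :: s | m <- mults n k,
                              s <- [seq s <- overpartitions n' (k - m * n)
                                   | ~~ head_overlined s]])
  else if k is 0 then [:: [::]] else [::].

Definition separated_bounded (n k : nat) (s : seq block) : bool :=
  [&& is_overpartition k s, block_separated s & all (fun B => bpart B <= n) s].

Lemma mem_mults d k m : (m \in mults d.+1 k) = (0 < m) && (m * d.+1 <= k).
Proof. by rewrite mem_iota add1n ltnS leq_divRL. Qed.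

Lemma path_bpart (B : block) s :
  path (fun B C => bpart C < bpart B) B s =
  all (fun C => bpart C < bpart B) s && sorted (fun B C => bpart C < bpart B) s.
Proof. by apply: path_sortedE => C D E; lia. Qed.

Lemma block_separated_cons (B : block) s :
  block_separated (B :: s) =
  ~~ (overlined B && head_overlined s) && block_separated s.
Proof. by case: s => [|C s] //=; rewrite andbF. Qed.

(** Parts strictly decrease, so the tail under a block of part [n.+1] may follow it exactly when its
    own parts are at most [n]. *)
Lemma separated_bounded_cons n k m x s :
  separated_bounded n.+1 k ((n.+1, m, x) :: s) =
  [&& m \in mults n.+1 k, ~~ (x && head_overlined s)
    & separated_bounded n (k - m * n.+1) s].
Proof.
rewrite /separated_bounded /is_overpartition block_separated_cons mem_mults.
rewrite big_cons /= path_bpart /bpart /bmult /overlined /= leqnn.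
rewrite (eq_all (a2 := fun C : block => C.1.1 <= n)) //.
case les: (all _ s); last by rewrite ?andbF.
have -> : all (fun B : block => B.1.1 <= n.+1) s.
  by apply: sub_all les => B; apply: leqW.
set S := \sum_(j <- s) _.
(* The guard [m * n.+1 <= k] compensates for truncated subtraction. *)
have -> : (m * n.+1 + S == k) = (m * n.+1 <= k) && (S == k - m * n.+1) by lia.
by case: (0 < m); case: (sorted _ s); case: (all _ s); case: (_ <= k);
  case: (S == _); case: (~~ _); case: block_separated.
Qed.

Lemma separated_bounded_gt n k B s :
  n < bpart B -> separated_bounded n k (B :: s) = false.
Proof.
by rewrite /separated_bounded /= ltnNge => /negPf ->; rewrite !andbF.
Qed.

(** Parts decrease, so the head bounds them all; the default 0 covers the empty list. *)
Lemma separated_boundedS n k s :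
  head 0 [seq bpart B | B <- s] <= n ->
  separated_bounded n.+1 k s = separated_bounded n k s.
Proof.
case: s => [|B s] //= le_B; rewrite /separated_bounded /= leqW // le_B.
case ov: (is_overpartition k (B :: s)) => //=.
move: ov; rewrite /is_overpartition /= path_bpart.
move=> /andP[/andP[/allP lt_s _] _].
have lt_n C : C \in s -> bpart C <= n by move=> /lt_s; lia.
congr (_ && _); transitivity true; last exact/esym/allP.
by apply/allP => C /lt_n /leqW.
Qed.

Lemma mem_overpartitions n k s :
  (s \in overpartitions n k) = separated_bounded n k s.
Proof.
elim: n k s => [|n IHn] k s.
  case: s => [|[[d m] x] s].
    by rewrite /separated_bounded /is_overpartition big_nil /=; case: k.
  rewrite /= (_ : _ \in _ = false); last by case: k.
  apply/esym/negbTE.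
  by rewrite /separated_bounded /is_overpartition /= /bpart /=; lia.
rewrite /= !mem_cat IHn.
(* A list headed by the part [n.+1] can only come from the two new families, any other list only
   from [overpartitions n k]. *)
have [[m [x [s' ->]]] | ne_s] :
    (exists m x s', s = (n.+1, m, x) :: s') \/
    head 0 [seq bpart B | B <- s] != n.+1.
  case: s => [|[[d m] x] s]; first by right.
  rewrite /= /bpart /=; case: eqP => [->|_]; last by right.
  by left; exists m, x, s.
- rewrite separated_bounded_cons separated_bounded_gt //=.
  apply/orP/and3P.
    case=> /allpairsPdep[m' [t [mem_m mem_t]]] [-> -> ->].
      by rewrite -IHn.
    by move: mem_t; rewrite mem_filter -IHn => /andP[].
  case=> mem_m; case: x => /= ht; rewrite -IHn => mem_s'.
    right; apply/allpairsPdep; exists m, s'; split=> //.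
    by rewrite mem_filter ht.
  by left; apply/allpairsPdep; exists m, s'.
- have new_part x (F : nat -> seq (seq block)) :
      s \in [seq (n.+1, m, x) :: t | m <- mults n.+1 k, t <- F m] = false.
    by apply/negP => /allpairsPdep[m [t [_ _ es]]]; rewrite es /= eqxx in ne_s.
  rewrite !new_part !orbF.
  have [gt_s|le_s] := ltnP n (head 0 [seq bpart B | B <- s]); last first.
    by rewrite separated_boundedS.
  case: s gt_s ne_s {new_part} => //= B s gt_B ne_B.
  by rewrite !separated_bounded_gt // ltn_neqAle eq_sym ne_B.
Qed.

(** The three families are disjoint: the first has no part [n.+1], and the other two differ in the
    overline of that part. *)
Lemma overpartitions_uniq n k : uniq (overpartitions n k).
Proof.
elim: n k => [|n IHn] k /=; first by case: k.
have uniq_new x (F : nat -> seq (seq block)) : (forall m, uniq (F m)) ->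
    uniq [seq (n.+1, m, x) :: s | m <- mults n.+1 k, s <- F m].
  move=> uF; apply: allpairs_uniq_dep => //; first exact: iota_uniq.
  by move=> [m s] [m' s'] _ _ [] /= -> ->.
have new_not_old x (F : nat -> seq (seq block)) s :
    s \in [seq (n.+1, m, x) :: s | m <- mults n.+1 k, s <- F m] ->
    s \notin overpartitions n k.
  case/allpairsPdep=> m [t [_ _ ->]]; rewrite mem_overpartitions.
  by rewrite separated_bounded_gt.
rewrite !cat_uniq IHn !uniq_new ?andbT //=; last by move=> m; apply: filter_uniq.
apply/andP; split; apply/hasPn => s.
  by rewrite mem_cat => /orP[]; apply: new_not_old.
case/allpairsPdep=> m [t [_ _ ->]].
by apply/negP => /allpairsPdep[m' [t' [_ _ []]]].
Qed.

(** No part of an overpartition of [k] exceeds [k], so the bound [n] is vacuous. *)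
Lemma b_size_overpartitions n k : k <= n -> b k = size (overpartitions n k).
Proof.
move=> le_kn; rewrite /b cardE -(size_map (@blocks_of k)).
apply/perm_size/uniq_perm; first 1 last.
- exact: overpartitions_uniq.
- move=> s; rewrite mem_overpartitions; apply/mapP/idP.
    case=> t; rewrite mem_enum inE => /andP[ov sep] ->.
    rewrite /separated_bounded ov sep.
    apply/allP => B Bs; apply: leq_trans le_kn.
    case/and3P: ov => _ /allP/(_ B Bs)/andP[_ m0] /eqP <-.
    by rewrite (big_rem B) //= (leq_trans _ (leq_addr _ _)) // leq_pmull.
  case/and3P=> ov sep _; have [t et] := overpartition_bounded ov.
  by exists t; rewrite // mem_enum inE et ov sep.
- by rewrite map_inj_uniq ?enum_uniq //; apply: blocks_of_inj.
Qed.

Lemma sum_mults (F : nat -> nat) d k :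
  \sum_(m <- mults d.+1 k) F (k - m * d.+1) =
  if d < k then F (k - d.+1) +
                \sum_(m <- mults d.+1 (k - d.+1)) F (k - d.+1 - m * d.+1)
  else 0.
Proof.
case: ltnP => [lt_dk | le_kd]; last by rewrite /mults divn_small // big_nil.
rewrite /mults -{1}(subnK lt_dk) divnDr // divnn addn1 /= big_cons mul1n.
rewrite -[2]/(1 + 1) iotaDl big_map; congr (_ + _).
by apply: eq_bigr => m _; rewrite mulnDl mul1n subnDA.
Qed.

Lemma count_prepend (T : eqType) (a : pred (seq T)) (r : seq nat)
    (h : nat -> T) (F : nat -> seq (seq T)) :
  count a [seq h m :: s | m <- r, s <- F m] =
  \sum_(m <- r) count (fun s => a (h m :: s)) (F m).
Proof.
elim: r => [|m r IHr]; first by rewrite big_nil.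
by rewrite big_cons allpairs_cons count_cat IHr count_map.
Qed.

(** The coefficients of q^k in G0^(n) and, for [nb_overlined], in G1^(n). *)
Definition nb_plain (n k : nat) : nat :=
  count (predC head_overlined) (overpartitions n k).
Definition nb_overlined (n k : nat) : nat :=
  count head_overlined (overpartitions n k).

Lemma nb_plain_overlined n k :
  nb_plain n k + nb_overlined n k = size (overpartitions n k).
Proof. by rewrite addnC count_predC. Qed.

Lemma nb_plainE n k :
  nb_plain n.+1 k =
  nb_plain n k +
  \sum_(m <- mults n.+1 k) size (overpartitions n (k - m * n.+1)).
Proof.
rewrite /nb_plain /= !count_cat !count_prepend /=; congr (_ + _).
rewrite [X in _ + X]big1 ?addn0 => [|m _]; last exact: count_pred0.
by apply: eq_bigr => m _; apply: count_predT.
Qed.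

Lemma nb_overlinedE n k :
  nb_overlined n.+1 k =
  nb_overlined n k + \sum_(m <- mults n.+1 k) nb_plain n (k - m * n.+1).
Proof.
rewrite /nb_overlined /= !count_cat !count_prepend /=; congr (_ + _).
rewrite [X in X + _]big1 ?add0n => [|m _]; last exact: count_pred0.
by apply: eq_bigr => m _; rewrite count_predT size_filter.
Qed.

(** Coefficient form of (1 - q^(n+1)) G0^(n+1) = G0^(n) + q^(n+1) G1^(n). *)
Lemma nb_plain_rec n k :
  nb_plain n.+1 k =
  nb_plain n k +
  if n < k then nb_plain n.+1 (k - n.+1) + nb_overlined n (k - n.+1) else 0.
Proof.
rewrite nb_plainE (sum_mults (fun j => size (overpartitions n j))).
by case: ltnP => // _; rewrite nb_plainE -nb_plain_overlined; lia.
Qed.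

(** Coefficient form of (1 - q^(n+1)) G1^(n+1) = q^(n+1) G0^(n) + (1 - q^(n+1)) G1^(n), with
    negative terms moved across to stay in [nat]. *)
Lemma nb_overlined_rec n k :
  nb_overlined n.+1 k + (if n < k then nb_overlined n (k - n.+1) else 0) =
  nb_overlined n k +
  if n < k then nb_overlined n.+1 (k - n.+1) + nb_plain n (k - n.+1) else 0.
Proof.
rewrite nb_overlinedE (sum_mults (nb_plain n)).
by case: ltnP => _; rewrite ?nb_overlinedE; lia.
Qed.

(** * Power series compared through polynomial truncations *)

Local Open Scope ring_scope.

(** Congruence modulo ['X^K], which lets series identities be proved with the ring laws of
    [{poly int}]. *)
Definition eq_upto (K : nat) (p r : {poly int}) : Prop :=
  forall i, (i < K)%N -> p`_i = r`_i.

Definition trunc (K : nat) (f : fps) : {poly int} := \poly_(i < K) f i.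

Lemma eq_upto_trans K p r s : eq_upto K p r -> eq_upto K r s -> eq_upto K p s.
Proof. by move=> pr rs i ltiK; rewrite pr // rs. Qed.

Lemma eq_uptoD K p p' r r' :
  eq_upto K p p' -> eq_upto K r r' -> eq_upto K (p + r) (p' + r').
Proof. by move=> pp' rr' i ltiK; rewrite !coefD pp' // rr'. Qed.

Lemma eq_uptoM K p p' r r' :
  eq_upto K p p' -> eq_upto K r r' -> eq_upto K (p * r) (p' * r').
Proof.
move=> pp' rr' i ltiK; rewrite !coefM; apply: eq_bigr => j _.
by rewrite pp' ?rr' // (leq_ltn_trans _ ltiK) ?leq_subr // -ltnS.
Qed.

Lemma coef_trunc K f i : (i < K)%N -> (trunc K f)`_i = f i.
Proof. by move=> ltiK; rewrite coef_poly ltiK. Qed.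

Lemma trunc_mul K f g :
  eq_upto K (trunc K (fps_mul f g)) (trunc K f * trunc K g).
Proof.
move=> i ltiK; rewrite coef_trunc // coefM; apply: eq_bigr => j _.
by rewrite !coef_trunc // (leq_ltn_trans _ ltiK) ?leq_subr // -ltnS.
Qed.

Lemma qpochS n : qpoch n.+1 = qpoch n * (1 - 'X^(n.+1)).
Proof. by rewrite /qpoch big_nat_recr. Qed.

(** The coefficient at [k] survives truncation at [k.+1], where associativity is that of
    polynomials. *)
Lemma fps_mulA f g h : fps_mul f (fps_mul g h) =1 fps_mul (fps_mul f g) h.
Proof.
move=> k; rewrite -[LHS](coef_trunc _ (ltnSn k)) -[RHS](coef_trunc _ (ltnSn k)).
rewrite !trunc_mul // (eq_uptoM (fun _ _ => erefl) (@trunc_mul _ g h)) // mulrA.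
by rewrite -(eq_uptoM (@trunc_mul _ f g) (fun _ _ => erefl)).
Qed.

Lemma fps_mulC f g : fps_mul f g =1 fps_mul g f.
Proof.
move=> k; rewrite -[LHS](coef_trunc _ (ltnSn k)) -[RHS](coef_trunc _ (ltnSn k)).
by rewrite !trunc_mul // mulrC.
Qed.

Lemma fps_mul1 f : fps_mul fps_one f =1 f.
Proof.
move=> k; rewrite /fps_mul /fps_one big_ord_recl big1 ?mul1r ?subn0 ?addr0 //.
by move=> i _; rewrite mul0r.
Qed.

Lemma eq_fps_mul f f' g g' :
  f =1 f' -> g =1 g' -> fps_mul f g =1 fps_mul f' g'.
Proof. by move=> ff' gg' k; apply: eq_bigr => i _; rewrite ff' gg'. Qed.

(** Passing from [u n] to [u n.+1] only affects coefficients of index at least [n.+1]. *)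
Lemma coef_stable (u v : nat -> {poly int}) :
  (forall n, u n.+1 = u n + 'X^(n.+1) * v n) ->
  forall k n, (k <= n)%N -> (u n)`_k = (u k)`_k.
Proof.
move=> uS k n /subnK <-; elim: (n - k)%N => [|m IHm] //.
by rewrite addSn uS coefD IHm coefXnM ltnS leq_addl addr0.
Qed.

(** * Generating functions of the counts and the limit identity *)

Definition plain_fps n : fps := fun k => (nb_plain n k)%:R.
Definition overlined_fps n : fps := fun k => (nb_overlined n k)%:R.

Lemma trunc_plain_rec K n :
  eq_upto K ((1 - 'X^(n.+1)) * trunc K (plain_fps n.+1))
            (trunc K (plain_fps n) + 'X^(n.+1) * trunc K (overlined_fps n)).
Proof.
move=> i ltiK; have ltijK j : (i - j < K)%N.
  by rewrite (leq_ltn_trans _ ltiK) ?leq_subr.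
rewrite mulrBl mul1r coefB coefD !coefXnM !coef_trunc //.
rewrite /plain_fps /overlined_fps nb_plain_rec ltnS; case: (leqP i n) => _.
  by rewrite addn0; ring.
by rewrite !natrD; ring.
Qed.

Lemma trunc_overlined_rec K n :
  eq_upto K ((1 - 'X^(n.+1)) * trunc K (overlined_fps n.+1))
            ('X^(n.+1) * trunc K (plain_fps n)
             + (1 - 'X^(n.+1)) * trunc K (overlined_fps n)).
Proof.
move=> i ltiK; have ltijK j : (i - j < K)%N.
  by rewrite (leq_ltn_trans _ ltiK) ?leq_subr.
rewrite !mulrBl !mul1r !(coefD, coefN, coefXnM) !coef_trunc //.
have /(congr1 (fun j => j%:R : int)) := nb_overlined_rec n i.
rewrite /plain_fps /overlined_fps ltnS; case: (leqP i n) => _.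
  by rewrite !addn0 => ->; ring.
by rewrite !natrD => /(canRL (addrK _)) ->; ring.
Qed.

(** Makes the limit (q)_oo invertible, as [fps_mulfV] requires. *)
Lemma qpoch_0 n : (qpoch n)`_0 = 1.
Proof.
elim: n => [|n IHn]; first by rewrite /qpoch big_nil coef1.
by rewrite qpochS mulrBr mulr1 coefB IHn mulrC coefXnM subr0.
Qed.

Theorem theorem3 (F0 F1 : nat -> {poly int})
    (F0_init : F0 0%N = 1) (F1_init : F1 0%N = 0)
    (F0_rec : forall n : nat, (1 <= n)%N ->
       F0 n = F0 n.-1 + 'X^n * F1 n.-1)
    (F1_rec : forall n : nat, (1 <= n)%N ->
       F1 n = 'X^n * F0 n.-1 + (1 - 'X^n) * F1 n.-1) :
  exists qinf F0inf F1inf : fps,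
    [/\ is_fps_lim qpoch qinf,
        is_fps_lim F0 F0inf,
        is_fps_lim F1 F1inf
      & genfun_b =1 fps_mul (fps_inv qinf) (fps_add F0inf F1inf)].
Proof.
have F0S n : F0 n.+1 = F0 n + 'X^(n.+1) * F1 n by rewrite F0_rec.
have F1S n : F1 n.+1 = 'X^(n.+1) * F0 n + (1 - 'X^(n.+1)) * F1 n.
  by rewrite F1_rec.
have q_stable k n : (k <= n)%N -> (qpoch n)`_k = (qpoch k)`_k.
  by apply: (coef_stable (v := fun n => - qpoch n)) => m; rewrite qpochS; ring.
(* The coefficient at [k] is final from index [k] on, so the limits are read off the diagonal. *)
exists (fun k => (qpoch k)`_k), (fun k => (F0 k)`_k), (fun k => (F1 k)`_k).
split; first by move=> k; exists k; apply: q_stable.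
- by move=> k; exists k; apply: coef_stable.
- move=> k; exists k; apply: (coef_stable (v := fun n => F0 n - F1 n)) => n.
  by rewrite F1S; ring.
(* F0^(n) = (q)_n G0^(n) and F1^(n) = (q)_n G1^(n) modulo every power of ['X], since both sides obey
   the same recurrences. *)
have F_qpoch K n :
    eq_upto K (F0 n) (qpoch n * trunc K (plain_fps n)) /\
    eq_upto K (F1 n) (qpoch n * trunc K (overlined_fps n)).
  elim: n => [|n [IH0 IH1]].
    by rewrite F0_init F1_init /qpoch big_nil !mul1r; split=> -[|i] ltiK;
      rewrite coef_trunc // ?coef1 ?coef0.
  rewrite F0S F1S qpochS -!mulrA; split.
    apply: eq_upto_trans (eq_uptoD IH0 (eq_uptoM (fun _ _ => erefl) IH1)) _.
    rewrite mulrCA -mulrDr; apply: eq_uptoM => //.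
    by move=> i ltiK; rewrite trunc_plain_rec.
  apply: eq_upto_trans (eq_uptoD (eq_uptoM (fun _ _ => erefl) IH0)
                                 (eq_uptoM (fun _ _ => erefl) IH1)) _.
  rewrite 2!(mulrCA _ (qpoch n)) -mulrDr; apply: eq_uptoM => //.
  by move=> i ltiK; rewrite trunc_overlined_rec.
set qinf : fps := fun k => (qpoch k)`_k; set Finf := fps_add _ _.
have FE : Finf =1 fps_mul qinf genfun_b.
  (* Taking n = k suffices: bounding parts by [k] loses no overpartition of a total at most [k], and
     truncation at [k.+1] keeps the coefficient at [k]. *)
  move=> k; have [e0 e1] := F_qpoch k.+1 k.
  rewrite /Finf /fps_add e0 // e1 // -coefD -mulrDr coefM.
  apply: eq_bigr => i _; rewrite q_stable -1?ltnS // coefD.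
  rewrite !coef_trunc ?ltnS ?leq_subr // -natrD nb_plain_overlined.
  by rewrite -b_size_overpartitions ?leq_subr.
(* Multiply [FE] by the inverse of [qinf], reading the left side as 1 times [genfun_b]. *)
move=> k; rewrite (eq_fps_mul (fun _ => erefl) FE) fps_mulA -[LHS]fps_mul1.
apply: eq_fps_mul => // i; rewrite fps_mulC fps_mulfV //.
by rewrite /qinf qpoch_0 unitr1.
Qed.
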